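(* Let $G=\mathbf{SU}(3)$ and let $\vec\xi=(\xi_1,\xi_2,\xi_3)$, $\xi_i=(\ell_i-m_i)\Omega_1+m_i\Omega_2$ with $\ell_i>m_i>0$, satisfy assumptions (A1), (A2), (A3) listed in the context, together with the input conditions of Suzuki and Takakura: all $\ell_i,m_i$ are integers divisible by $3$, and $(\vec w\odot\vec\xi,\Omega_1)\ne0$ for all $\vec w\in W^3$. Then, with $K=-\tfrac16$, the volume expression $$K\cdot\sum_{i=0}^{5}\sum_{j=0}^{5}\sum_{k=0}^{5}(-1)^{i+j+k}\max\left(\min\left(P^{(1)}_{ijk}(\vec\xi),P^{(2)}_{ijk}(\vec\xi)\right),0\right)$$ is equal to the Suzuki-Takakura volume expression $$\mathcal V(\vec\xi)=\sum_{(I_1,\dots,I_6)\in\mathcal I_{\vec\xi}}A_{\vec\xi}(I_1,\dots,I_6)+\sum_{(I_1,\dots,I_6)\in\mathcal J_{\vec\xi}}B_{\vec\xi}(I_1,\dots,I_6).$$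
   Context: Setting. $G=\mathbf{SU}(3)$, $\mathfrak g=\mathfrak{su}(3)$, $T$ the diagonal maximal torus with Lie algebra $\mathfrak t$. $(X,Y)=-\mathrm{tr}(XY)$. $\mathbf i=\sqrt{-1}$. $\Omega_1=\tfrac{2\pi\mathbf i}{3}\mathrm{diag}(2,-1,-1)$, $\Omega_2=\tfrac{2\pi\mathbf i}{3}\mathrm{diag}(1,1,-2)$. The closed (resp. open) positive Weyl chamber $\mathfrak t_{\ge0}$ (resp. $\mathfrak t_{>0}$) is the set of $c_1\Omega_1+c_2\Omega_2$ with $c_1,c_2\ge0$ (resp. $>0$). The Weyl group $W\cong\mathfrak S_3$ acts on $\mathfrak t$ by permuting diagonal entries, and $\vec w\odot\vec\xi=\sum_{i=1}^3w_i\cdot\xi_i$ for $\vec w\in W^3$. Assumptions. With $\mathcal O_\xi$ the adjoint orbit of $\xi$ (with the Kirillov-Kostant-Souriau form), $M=\mathcal O_{\xi_1}\times\mathcal O_{\xi_2}\times\mathcal O_{\xi_3}$ has the diagonal adjoint action of $G$, with moment map $\mu_G(\eta_1,\eta_2,\eta_3)=\eta_1+\eta_2+\eta_3$; $M_{\mathrm{red}}(\vec\xi)=\mu_G^{-1}(0)/G$. (A1) $\mu_G^{-1}(0)\ne\emptyset$ and $0$ is a regular value of $\mu_G$. (A2) $\xi_i\in\mathfrak t_{\ge0}$ for all $i$ and each $\mathcal O_{\xi_i}$ is diffeomorphic to $G/T$ (equivalently, $\xi_i\in\mathfrak t_{>0}$). (A3) $M_{\mathrm{red}}(\vec\xi)$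 is a smooth manifold (equivalently, $\mathrm{Stab}_G(\vec\eta)=Z(G)$ for every $\vec\eta\in\mu_G^{-1}(0)$). First expression. With respect to the basis $\{\Omega_1,\Omega_2-\Omega_1\}$ of $\mathfrak t$, the elements of $W$ are $$\mathfrak s_0=\begin{pmatrix}1&0\\0&1\end{pmatrix},\ \mathfrak s_1=\begin{pmatrix}0&1\\1&0\end{pmatrix},\ \mathfrak s_2=\begin{pmatrix}0&-1\\1&-1\end{pmatrix},\ \mathfrak s_3=\begin{pmatrix}-1&0\\-1&1\end{pmatrix},\ \mathfrak s_4=\begin{pmatrix}-1&1\\-1&0\end{pmatrix},\ \mathfrak s_5=\begin{pmatrix}1&-1\\0&-1\end{pmatrix},$$ and $P_{ijk}(\vec\xi)=\mathfrak s_i\binom{\ell_1}{m_1}+\mathfrak s_j\binom{\ell_2}{m_2}+\mathfrak s_k\binom{\ell_3}{m_3}\in\mathbb R^2$, $P^{(1)}_{ijk}=(\tfrac23\mathrm{pr}_1-\tfrac13\mathrm{pr}_2)(P_{ijk})$, $P^{(2)}_{ijk}=(\tfrac13\mathrm{pr}_1+\tfrac13\mathrm{pr}_2)(P_{ijk})$, with $\mathrm{pr}_1,\mathrm{pr}_2$ the coordinate projections. Suzuki-Takakura expression. $L=\ell_1+\ell_2+\ell_3$, $M=m_1+m_2+m_3$ (here $M$ denotes a number). For disjoint $I,J\subset\{1,2,3\}$: $\ell_{I,J}=\sum_{i\in I\sqcup J}\ell_i$, $m_{I,J}=\sum_{i\in I\sqcup J}m_i$. A $6$-partition of $\{1,2,3\}$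 is a $6$-tuple $(I_1,\dots,I_6)$ of pairwise disjoint (possibly empty) subsets with union $\{1,2,3\}$. $\mathcal I_{\vec\xi}$ is the set of $6$-partitions with $$\ell_{I_1,I_2}+m_{I_4,I_5}<\tfrac{L+M}{3}\quad\text{and}\quad \ell_{I_3,I_4}+m_{I_6,I_1}<\tfrac{L+M}{3};$$ $\mathcal J_{\vec\xi}$ is the set of $6$-partitions with $$\ell_{I_3,I_4}+m_{I_6,I_1}>\tfrac{L+M}{3}\quad\text{and}\quad \ell_{I_5,I_6}+m_{I_2,I_3}>\tfrac{L+M}{3}.$$ Furthermore $$A_{\vec\xi}(I_1,\dots,I_6)=\tfrac{-(-1)^{|I_1|+|I_3|+|I_5|}}{6}\left(\tfrac{L+M}{3}-\ell_{I_1,I_2}-m_{I_4,I_5}\right),$$ $$B_{\vec\xi}(I_1,\dots,I_6)=\tfrac{-(-1)^{|I_1|+|I_3|+|I_5|}}{6}\left(\ell_{I_5,I_6}+m_{I_2,I_3}-\tfrac{L+M}{3}\right).$$ *)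

(* Defs.v *)
From HB Require Import structures.
From mathcomp Require Import all_boot all_order all_algebra all_fingroup.
From mathcomp Require Import sesquilinear spectral complex.
From mathcomp Require Import all_classical all_reals all_analysis.
Set Implicit Arguments.
Unset Strict Implicit.
Unset Printing Implicit Defensive.
Import Order.TTheory GRing.Theory Num.Theory.
Import numFieldNormedType.Exports.
Local Open Scope classical_set_scope.
Local Open Scope sesquilinear_scope.
Local Open Scope complex_scope.
Local Open Scope ring_scope.

Section SU3.
Variable R : realType.
Notation C := R[i].
Notation Mat := 'M[C]_3.

Definition SU3 : set Mat := [set g | g \is unitarymx /\ \det g = 1].

Definition su3 : set Mat := [set X | X ^t* = - X /\ \tr X = 0].

Definition SU3_center : set Mat :=
  [set z | SU3 z /\ forall g, SU3 g -> z *m g = g *m z].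

Definition Ad (g X : Mat) : Mat := g *m X *m invmx g.

Definition ip (X Y : Mat) : C := - \tr (X *m Y).

Definition diag3 (a b c : C) : Mat :=
  \matrix_(i, j) (nth 0 [:: a; b; c] i *+ (i == j)).

Definition Omega1 : Mat :=
  ((2 * pi / 3 : R)%:C * 'i%C) *: diag3 2 (-1) (-1).
Definition Omega2 : Mat :=
  ((2 * pi / 3 : R)%:C * 'i%C) *: diag3 1 1 (-2).

Definition closed_chamber : set Mat :=
  [set X | exists c1 c2 : R, [/\ 0 <= c1, 0 <= c2 &
     X = c1%:C *: Omega1 + c2%:C *: Omega2]].

Definition open_chamber : set Mat :=
  [set X | exists c1 c2 : R, [/\ 0 < c1, 0 < c2 &
     X = c1%:C *: Omega1 + c2%:C *: Omega2]].

(* On diagonal matrices this permutes the diagonal entries. *)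
Definition weyl_act (w : 'S_3) (X : Mat) : Mat :=
  \matrix_(i, j) X (w^-1%g i) (w^-1%g j).

Definition odot (w : 'I_3 -> 'S_3) (xi : 'I_3 -> Mat) : Mat :=
  \sum_i weyl_act (w i) (xi i).

Definition adj_orbit (xi : Mat) : set Mat := [set Ad g xi | g in SU3].

Definition orbit_prod (xi : 'I_3 -> Mat) : set ('I_3 -> Mat) :=
  [set eta | forall i, adj_orbit (xi i) (eta i)].

(* g^* is identified with g through ip. *)
Definition moment_map (eta : 'I_3 -> Mat) : Mat := \sum_i eta i.

Definition zero_fiber (xi : 'I_3 -> Mat) : set ('I_3 -> Mat) :=
  [set eta | orbit_prod xi eta /\ moment_map eta = 0].

Definition velocity0 (c : R -> Mat) (v : Mat) : Prop :=
  forall i j,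
    is_derive (0 : R) (1 : R) (fun t => complex.Re (c t i j))
      (complex.Re (v i j)) /\
    is_derive (0 : R) (1 : R) (fun t => complex.Im (c t i j))
      (complex.Im (v i j)).

(* The orbit is a compact embedded submanifold of the space of matrices, so
   its tangent space at eta consists of the velocities of curves in it. *)
Definition orbit_tangent (xi eta : Mat) : set Mat :=
  [set v | exists c : R -> Mat,
     [/\ forall t, adj_orbit xi (c t), c 0 = eta & velocity0 c v]].

(* moment_map is linear, hence its differential sends the tangent vector
   (v_1, v_2, v_3) to moment_map v. *)
Definition zero_regular_value (xi : 'I_3 -> Mat) : Prop :=
  forall eta, zero_fiber xi eta ->
  forall Z, su3 Z ->
  exists2 v : 'I_3 -> Mat,
    (forall i, orbit_tangent (xi i) (eta i) (v i)) & moment_map v = Z.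

Definition stabilizer (eta : 'I_3 -> Mat) : set Mat :=
  [set g | SU3 g /\ forall i, Ad g (eta i) = eta i].

Definition assumption_A1 (xi : 'I_3 -> Mat) : Prop :=
  zero_fiber xi !=set0 /\ zero_regular_value xi.

(* For xi in the closed chamber, its orbit is diffeomorphic to SU(3)/T if and
   only if xi is in the open chamber. *)
Definition assumption_A2 (xi : 'I_3 -> Mat) : Prop :=
  forall i, closed_chamber (xi i) /\ open_chamber (xi i).

(* Under A1, the condition for the quotient of zero_fiber xi by SU(3) to be a
   smooth manifold rather than an orbifold. *)
Definition assumption_A3 (xi : 'I_3 -> Mat) : Prop :=
  forall eta, zero_fiber xi eta -> stabilizer eta = SU3_center.

Section Volumes.
Variables l m : 'I_3 -> R.

Definition xi_of (i : 'I_3) : Mat :=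
  (l i - m i)%:C *: Omega1 + (m i)%:C *: Omega2.

Definition mat2 (a b c d : R) : 'M[R]_2 :=
  \matrix_(i, j) nth 0 (nth [::] [:: [:: a; b]; [:: c; d]] i) j.

(* The Weyl group elements in the basis Omega1, Omega2 - Omega1; in it xi_of i
   has coordinates (l i, m i). *)
Definition weyl_mx (k : nat) : 'M[R]_2 :=
  nth 0 [:: mat2 1 0 0 1; mat2 0 1 1 0; mat2 0 (-1) 1 (-1);
            mat2 (-1) 0 (-1) 1; mat2 (-1) 1 (-1) 0; mat2 1 (-1) 0 (-1)] k.

Definition coords (a : 'I_3) : 'cV[R]_2 :=
  \col_k nth 0 [:: l a; m a] k.

Definition Pvec (i j k : nat) : 'cV[R]_2 :=
  weyl_mx i *m coords 0 + weyl_mx j *m coords 1 + weyl_mx k *m coords 2.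

Definition P1 (i j k : nat) : R :=
  2 / 3 * Pvec i j k 0 0 - 1 / 3 * Pvec i j k 1 0.

Definition P2 (i j k : nat) : R :=
  1 / 3 * Pvec i j k 0 0 + 1 / 3 * Pvec i j k 1 0.

Definition volume_weyl (K : R) : R :=
  K * \sum_(i < 6) \sum_(j < 6) \sum_(k < 6)
        (-1) ^+ (i + j + k) * Num.max (Num.min (P1 i j k) (P2 i j k)) 0.

Definition six_partition (I : 6.-tuple {set 'I_3}) : bool :=
  pairwise (fun A B : {set 'I_3} => A :&: B == finset.set0) I &&
  (\big[@finset.setU 'I_3/finset.set0]_(A <- I) A == finset.setTfor 'I_3).

(* The k-th block, with the 1-based numbering I_1, ..., I_6. *)
Definition blk (I : 6.-tuple {set 'I_3}) (k : nat) : {set 'I_3} :=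
  nth finset.set0 I k.-1.

Definition l_sum (A B : {set 'I_3}) : R := \sum_(i in A :|: B) l i.
Definition m_sum (A B : {set 'I_3}) : R := \sum_(i in A :|: B) m i.

Definition LM3 : R := (\sum_i l i + \sum_i m i) / 3.

Definition inI (I : 6.-tuple {set 'I_3}) : bool :=
  [&& six_partition I,
      l_sum (blk I 1) (blk I 2) + m_sum (blk I 4) (blk I 5) < LM3
    & l_sum (blk I 3) (blk I 4) + m_sum (blk I 6) (blk I 1) < LM3].

Definition inJ (I : 6.-tuple {set 'I_3}) : bool :=
  [&& six_partition I,
      l_sum (blk I 3) (blk I 4) + m_sum (blk I 6) (blk I 1) > LM3
    & l_sum (blk I 5) (blk I 6) + m_sum (blk I 2) (blk I 3) > LM3].

Definition sgnI (I : 6.-tuple {set 'I_3}) : R :=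
  (-1) ^+ (#|blk I 1| + #|blk I 3| + #|blk I 5|).

Definition coef_A (I : 6.-tuple {set 'I_3}) : R :=
  - sgnI I / 6 *
  (LM3 - l_sum (blk I 1) (blk I 2) - m_sum (blk I 4) (blk I 5)).

Definition coef_B (I : 6.-tuple {set 'I_3}) : R :=
  - sgnI I / 6 *
  (l_sum (blk I 5) (blk I 6) + m_sum (blk I 2) (blk I 3) - LM3).

Definition volume_ST : R :=
  \sum_(I : 6.-tuple {set 'I_3} | inI I) coef_A I +
  \sum_(I : 6.-tuple {set 'I_3} | inJ I) coef_B I.

End Volumes.
End SU3.

(* Main.v *)
(* Placing each of 1, 2, 3 in one of six blocks amounts to choosing a triple of
   Weyl elements, so both volumes are signed sums, over the 216 triples, of
   functions of the diagonal entries (x, y, z), x + y + z = 0, of w (.) xi, up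
   to a factor 2 pi i.  Reversing the order of the blocks exchanges x and z and
   reverses the sign of the triple.  The difference of the two summands is
   invariant under this exchange as soon as y <> 0, which genericity ensures,
   so its signed sum vanishes. *)
Require Import Defs.
From mathcomp Require Import all_boot all_order all_algebra all_fingroup.
From mathcomp Require Import complex.
From mathcomp Require Import all_classical all_reals all_analysis.
From mathcomp Require Import ring lra.
Set Implicit Arguments.
Unset Strict Implicit.
Unset Printing Implicit Defensive.
Import Order.TTheory GRing.Theory Num.Theory.
Local Open Scope ring_scope.

Lemma ord3P (P : 'I_3 -> Prop) :
  P 0 -> P 1 -> P (lift ord0 (lift ord0 ord0)) -> forall i, P i.
Proof.
move=> P0 P1 P2 [[|[|[|//]]] hi].
- by rewrite (_ : Ordinal hi = 0) //; apply: val_inj.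
- by rewrite (_ : Ordinal hi = 1) //; apply: val_inj.
- by rewrite (_ : Ordinal hi = lift ord0 (lift ord0 ord0)) //; apply: val_inj.
Qed.

(* [coordX p q k], [coordY p q k], [coordZ p q k] are what an element of the
   block [I_(k+1)] with values [l = p], [m = q] adds to the left-hand sides of
   the inequalities defining [inI] and [inJ]; they permute [p, q, 0]. *)
Section BlockCoordinates.
Variable R : realType.

Definition coordX (p q : R) (k : nat) : R := nth 0 [:: p; p; 0; q; q; 0] k.
Definition coordY (p q : R) (k : nat) : R := nth 0 [:: q; 0; p; p; 0; q] k.
Definition coordZ (p q : R) (k : nat) : R := nth 0 [:: 0; q; q; 0; p; p] k.

Lemma coord_rev p q (k : 'I_6) :
  [/\ coordX p q (rev_ord k) = coordZ p q k,
      coordY p q (rev_ord k) = coordY p q k &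
      coordZ p q (rev_ord k) = coordX p q k].
Proof. by case: k => [[|[|[|[|[|[|]]]]]] ?]. Qed.

Lemma coord_sum p q (k : 'I_6) :
  coordX p q k + coordY p q k + coordZ p q k = p + q.
Proof.
by case: k => [[|[|[|[|[|[|//]]]]]] ?];
  rewrite /coordX /coordY /coordZ /=; ring.
Qed.

(** Reversal sends [k] to [5 - k], which changes parity. *)
Lemma signr_rev_ord6 (k : 'I_6) : (-1) ^+ rev_ord k = - (-1) ^+ k :> R.
Proof. by case: k => [[|[|[|[|[|[|//]]]]]] ?] /=; ring. Qed.

(** * Signed sums over assignments of blocks *)

Section Sums.
Variables l m : 'I_3 -> R.
Implicit Type b : {ffun 'I_3 -> 'I_6}.

(** Subtracting [LM3] makes the trace zero: times [2 pi i], the three values are the diagonal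
    entries of a point [w (.) xi]. *)
Definition posX b : R := \sum_a coordX (l a) (m a) (b a) - LM3 l m.
Definition posY b : R := \sum_a coordY (l a) (m a) (b a) - LM3 l m.
Definition posZ b : R := \sum_a coordZ (l a) (m a) (b a) - LM3 l m.
Definition bsign b : R := \prod_a (-1) ^+ (b a).
Definition brev b : {ffun 'I_3 -> 'I_6} := [ffun a => rev_ord (b a)].

Lemma brevK : involutive brev.
Proof. by move=> b; apply/ffunP => a; rewrite !ffunE rev_ordK. Qed.

Lemma pos_brev b :
  [/\ posX (brev b) = posZ b, posY (brev b) = posY b & posZ (brev b) = posX b].
Proof.
by split; congr (_ - _); apply: eq_bigr => a _; rewrite ffunE;
  case: (coord_rev (l a) (m a) (b a)).
Qed.

Lemma bsign_brev b : bsign (brev b) = - bsign b.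
Proof.
rewrite /bsign; under eq_bigr do rewrite ffunE signr_rev_ord6.
by rewrite prodrN card_ord; ring.
Qed.

Lemma pos_sum b : posX b + posY b + posZ b = 0.
Proof.
have : \sum_a coordX (l a) (m a) (b a) + \sum_a coordY (l a) (m a) (b a)
  + \sum_a coordZ (l a) (m a) (b a) = \sum_a l a + \sum_a m a.
  by rewrite -!big_split; apply: eq_bigr => a _; apply: coord_sum.
rewrite /posX /posY /posZ /LM3; lra.
Qed.

(** The involution [brev] keeps the value of [f] and flips [bsign], so the sum equals its own
    negative. *)
Lemma sum_bsign_rev_eq0 (f : R -> R -> R -> R) :
    (forall b, f (posX b) (posY b) (posZ b) = f (posZ b) (posY b) (posX b)) ->
  \sum_b bsign b * f (posX b) (posY b) (posZ b) = 0.
Proof.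
move=> fC; set S := \sum_b _.
suff: S = - S by lra.
rewrite {1}/S (reindex_inj (inv_inj brevK)) -sumrN; apply: eq_bigr => b _.
by have [-> -> ->] := pos_brev b; rewrite bsign_brev -fC mulNr.
Qed.

(** * Assignments of blocks and 6-partitions *)

Definition blocks b : 6.-tuple {set 'I_3} :=
  [tuple finset (fun a => b a == k) | k < 6].

Lemma blk_blocks b (k : nat) : (k < 6)%N ->
  blk (blocks b) k.+1 = finset (fun a => b a == k :> nat).
Proof.
move=> k6; rewrite /blk -[nth _ _ _](tnth_nth _ _ (Ordinal k6)) tnth_mktuple.
by apply/setP => a; rewrite !inE -val_eqE.
Qed.

Lemma six_partition_blocks b : six_partition (blocks b).
Proof.
apply/andP; split.
  apply/(pairwiseP finset.set0) => i j; rewrite !inE size_tuple => ilt jlt ij.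
  rewrite -[nth _ _ i](tnth_nth _ (blocks b) (Ordinal ilt)).
  rewrite -[nth _ _ j](tnth_nth _ (blocks b) (Ordinal jlt)) !tnth_mktuple.
  apply/eqP/setP => a; rewrite !inE; apply/negP => /andP[/eqP -> /eqP[ji]].
  by rewrite ji ltnn in ij.
apply/eqP/setP => a; rewrite inE big_tuple; apply/bigcupP.
by exists (b a) => //; rewrite tnth_mktuple inE.
Qed.

(** The default [ord0] arises only when [a] lies in no block, which never happens for a
    6-partition. *)
Definition block_of (I : 6.-tuple {set 'I_3}) : {ffun 'I_3 -> 'I_6} :=
  [ffun a => odflt ord0 [pick k | a \in tnth I k]].

Lemma blocksK b : block_of (blocks b) = b.
Proof.
apply/ffunP => a; rewrite ffunE; case: pickP => [k|/(_ (b a))] /=.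
  by rewrite tnth_mktuple inE => /eqP.
by rewrite tnth_mktuple inE eqxx.
Qed.

Lemma block_ofK I : six_partition I -> blocks (block_of I) = I.
Proof.
case/andP => /(pairwiseP finset.set0) disjI /eqP coverI.
apply: eq_from_tnth => k; rewrite tnth_mktuple; apply/setP => a.
rewrite inE ffunE; case: pickP => [k' ak'|noa] /=; last first.
  have: a \in finset.setTfor 'I_3 by rewrite inE.
  by rewrite -coverI big_tuple => /bigcupP[j _]; rewrite noa.
apply/eqP/idP => [<- //|ak].
have sz (i : 'I_6) : (nat_of_ord i) \in gtn (size I) by rewrite inE size_tuple.
have disj (i j : 'I_6) : (i < j)%N -> a \in tnth I i -> a \in tnth I j -> False.
  move=> /(disjI _ _ (sz i) (sz j)) /eqP; rewrite -!tnth_nth => /setP/(_ a).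
  by rewrite !inE => + ai aj; rewrite ai aj.
by case: (ltngtP k' k) => [kk|kk|/val_inj //]; [case: (disj k' k)|case: (disj k k')].
Qed.

(** The image of [blocks] consists of the 6-partitions only; the hypothesis on [P] confines the sum
    to it, where [block_of] is the inverse. *)
Lemma sum_six_partition (P : pred (6.-tuple {set 'I_3})) F :
    (forall I, P I -> six_partition I) ->
  \sum_(I | P I) F I = \sum_b (if P (blocks b) then F (blocks b) else 0) :> R.
Proof.
move=> sP; rewrite -big_mkcond (reindex blocks) //.
exists block_of => [b _|I]; first exact: blocksK.
by rewrite inE => /sP /block_ofK.
Qed.

Lemma sum_blk2 (F : 'I_3 -> R) b (i j : nat) : (i < 6)%N -> (j < 6)%N ->
  \sum_(a in blk (blocks b) i.+1 :|: blk (blocks b) j.+1) F a =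
  \sum_a (if (b a == i :> nat) || (b a == j :> nat) then F a else 0).
Proof.
move=> i6 j6; rewrite !blk_blocks // big_mkcond /=.
by apply: eq_bigr => a _; rewrite !inE.
Qed.

Lemma sum_coord_blk b :
  [/\ l_sum l (blk (blocks b) 1) (blk (blocks b) 2) +
      m_sum m (blk (blocks b) 4) (blk (blocks b) 5) = posX b + LM3 l m,
      l_sum l (blk (blocks b) 3) (blk (blocks b) 4) +
      m_sum m (blk (blocks b) 6) (blk (blocks b) 1) = posY b + LM3 l m &
      l_sum l (blk (blocks b) 5) (blk (blocks b) 6) +
      m_sum m (blk (blocks b) 2) (blk (blocks b) 3) = posZ b + LM3 l m].
Proof.
rewrite /l_sum /m_sum !sum_blk2 // !subrK -!big_split.
by split; apply: eq_bigr => a _; case: (b a) => [[|[|[|[|[|[|//]]]]]] ?];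
  rewrite /coordX /coordY /coordZ /= ?addr0 ?add0r.
Qed.

(** The blocks counted by [sgnI] have even 0-based index, so an element of block [k] contributes
    [- (-1)^k]; three such signs leave one minus. *)
Lemma sgnI_blocks b : sgnI R (blocks b) = - bsign b.
Proof.
have cardE (P : pred 'I_3) : #|finset P| = (\sum_a P a)%N.
  rewrite -sum1_card big_mkcond; apply: eq_bigr => a _.
  by rewrite inE; case: (P a).
rewrite /sgnI !blk_blocks // !cardE -!big_split /= expr_sum.
have -> : - bsign b = \prod_a - (-1) ^+ (b a).
  by rewrite prodrN card_ord -signr_odd expr1 mulN1r.
apply: eq_bigr => a _.
by case: (b a) => [[|[|[|[|[|[|//]]]]]] ?] /=; ring.
Qed.

(** * Assignments of blocks and triples of Weyl elements *)

(* [weyl_block k] is the (0-based) block whose arrangement of [l, m, 0] is the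
   diagonal produced by the [k]-th Weyl matrix. *)
Definition weyl_block (k : 'I_6) : 'I_6 :=
  inord (nth 0%N [:: 0; 3; 2; 5; 4; 1]%N k).

Lemma weyl_block_inj : injective weyl_block.
Proof.
(* The inverse table: [weyl_block] fixes even indices and moves odd ones in the cycle 1, 3, 5. *)
apply: (can_inj (g := fun k : 'I_6 => inord (nth 0 [:: 0; 5; 2; 1; 4; 3] k)%N)).
by case=> [[|[|[|[|[|[|//]]]]]] ?]; apply: val_inj; rewrite /weyl_block /= !inordK.
Qed.

(** In the basis [Omega1], [Omega2 - Omega1], the traceless diagonal matrix with entries
    [2 pi i (x, y, z)] has coordinates [(x - z, y - z)]. *)
Lemma weyl_mx_coords (k : 'I_6) a :
  (weyl_mx R k *m coords l m a) 0 0 =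
    coordX (l a) (m a) (weyl_block k) - coordZ (l a) (m a) (weyl_block k) /\
  (weyl_mx R k *m coords l m a) 1 0 =
    coordY (l a) (m a) (weyl_block k) - coordZ (l a) (m a) (weyl_block k).
Proof.
by case: k => [[|[|[|[|[|[|//]]]]]] ?]; rewrite /weyl_mx /mat2 /=
  !mxE !big_ord_recl !big_ord0 !mxE /= /weyl_block !inordK //=
  /coordX /coordY /coordZ /=; split; ring.
Qed.

Definition weyl_blocks (p : 'I_6 * 'I_6 * 'I_6) : {ffun 'I_3 -> 'I_6} :=
  [ffun a : 'I_3 => weyl_block (nth p.1.1 [:: p.1.1; p.1.2; p.2] a)].

Lemma weyl_blocks_inj : injective weyl_blocks.
Proof.
move=> [[i j] k] [[i' j'] k'] /ffunP e.
have := e 0; have := e 1; have := e (lift ord0 (lift ord0 ord0)).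
by rewrite !ffunE /= => /weyl_block_inj -> /weyl_block_inj -> /weyl_block_inj ->.
Qed.

Lemma weyl_blocks_bij : bijective weyl_blocks.
Proof.
apply: inj_card_bij; first exact: weyl_blocks_inj.
by rewrite card_ffun !card_prod !card_ord.
Qed.

(** Since [x + y + z = 0], the combinations of [x - z] and [y - z] in [P1] and [P2] simplify to [x]
    and [- z]. *)
Lemma P12_weyl_blocks (i j k : 'I_6) :
  P1 l m i j k = posX (weyl_blocks (i, j, k)) /\
  P2 l m i j k = - posZ (weyl_blocks (i, j, k)).
Proof.
have s0 := coord_sum (l 0) (m 0) (weyl_block i).
have s1 := coord_sum (l 1) (m 1) (weyl_block j).
have s2 := coord_sum (l (lift ord0 (lift ord0 ord0)))
  (m (lift ord0 (lift ord0 ord0))) (weyl_block k).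
have two : 2 = lift ord0 (lift ord0 ord0) :> 'I_3 by apply: val_inj.
have [i0 i1] := weyl_mx_coords i 0.
have [j0 j1] := weyl_mx_coords j 1.
have [k0 k1] := weyl_mx_coords k (lift ord0 (lift ord0 ord0)).
have one : lift ord0 ord0 = 1 :> 'I_3 by apply: val_inj.
have addE (A B : 'cV[R]_2) r : (A + B) r 0 = A r 0 + B r 0 by rewrite mxE.
rewrite /P1 /P2 /Pvec two !addE i0 i1 j0 j1 k0 k1 /posX /posZ /LM3.
rewrite !big_ord_recl !big_ord0 !ffunE /= one; split; lra.
Qed.

Lemma bsign_weyl_blocks (i j k : 'I_6) :
  (-1) ^+ (i + j + k) = bsign (weyl_blocks (i, j, k)).
Proof.
have sgn (n : 'I_6) : (-1) ^+ weyl_block n = (-1) ^+ n :> R.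
  by case: n => [[|[|[|[|[|[|//]]]]]] ?]; rewrite /weyl_block inordK //=; ring.
by rewrite /bsign !big_ord_recl big_ord0 !ffunE /= !sgn !exprD mulr1 mulrA.
Qed.

End Sums.
End BlockCoordinates.

(** * The genericity condition in coordinates *)

Section Pairing.
Variable R : realType.
Notation C := R[i].

Let kappa : C := ((2 * pi / 3 : R)%:C * 'i)%C.

(** [Omega1] is [kappa] times [3 E - 1], with [E] the first diagonal matrix unit. *)
Lemma ip_Omega1 (X : 'M[C]_3) : ip X (Omega1 R) = - kappa * (3 * X 0 0 - \tr X).
Proof.
rewrite /ip /mxtrace.
under eq_bigr do rewrite !mxE !big_ord_recl big_ord0 !mxE.
rewrite !big_ord_recl !big_ord0 /= -/kappa; ring.
Qed.

Lemma xi_ofE (l m : 'I_3 -> R) a i :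
  xi_of l m a i i =
    kappa * (3 * nth 0 [:: l a; m a; 0] i - (l a + m a))%:C%C.
Proof.
rewrite !mxE !eqxx -/kappa !rmorphB !rmorphD !rmorphM /= rmorph_nat.
by elim/ord3P: i => /=; rewrite ?rmorph0; ring.
Qed.

Lemma mxtrace_weyl_act (w : 'S_3) (X : 'M[C]_3) : \tr (weyl_act w X) = \tr X.
Proof.
rewrite /mxtrace [RHS](reindex_inj (@perm_inj _ w^-1%g)).
by apply: eq_bigr => i _; rewrite mxE.
Qed.

Lemma mxtrace_xi_of (l m : 'I_3 -> R) a : \tr (xi_of l m a) = 0.
Proof.
rewrite /mxtrace; under eq_bigr do rewrite xi_ofE.
rewrite -mulr_sumr -rmorph_sum !big_ord_recl big_ord0 /=.
by rewrite (_ : _ + _ = 0) ?rmorph0 ?mulr0 //; ring.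
Qed.

Lemma ip_odot (l m : 'I_3 -> R) (w : 'I_3 -> 'S_3) :
  ip (odot w (xi_of l m)) (Omega1 R) =
  - 9 * kappa ^+ 2 *
    (\sum_a nth 0 [:: l a; m a; 0] ((w a)^-1%g 0) - LM3 l m)%:C%C.
Proof.
have tr0 : \tr (odot w (xi_of l m)) = 0.
  rewrite raddf_sum big1 // => a _ /=.
  by rewrite mxtrace_weyl_act mxtrace_xi_of.
rewrite ip_Omega1 tr0 subr0 summxE; under eq_bigr do rewrite mxE xi_ofE.
rewrite -mulr_sumr -rmorph_sum /= sumrB -mulr_sumr big_split /=.
set S := \sum_(a < 3) _; rewrite (_ : 3 * S - _ = 3 * (S - LM3 l m)); last first.
  by rewrite /LM3; field.
rewrite rmorphM rmorph_nat /=; ring.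
Qed.

Lemma posY_neq0 (l m : 'I_3 -> R) (b : {ffun 'I_3 -> 'I_6}) :
    (forall w : 'I_3 -> 'S_3, ip (odot w (xi_of l m)) (Omega1 R) <> 0) ->
  posY l m b != 0.
Proof.
move=> hgen; apply/eqP => Y0.
(* [coordY p q k] is entry [d k] of [p, q, 0]. *)
pose d (k : 'I_6) : 'I_3 := inord (nth 0 [:: 1; 2; 0; 0; 2; 1] k)%N.
(* Genericity concerns the first diagonal entry, so a transposition in each factor brings there the
   entry that [coordY] selects. *)
apply: (hgen (fun a => tperm 0 (d (b a)))); rewrite ip_odot.
have -> : \sum_a nth 0 [:: l a; m a; 0] ((tperm 0 (d (b a)))^-1%g 0)
    = \sum_a coordY (l a) (m a) (b a).
  apply: eq_bigr => a _; rewrite tpermV tpermL /d.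
  by case: (b a) => [[|[|[|[|[|[|//]]]]]] ?]; rewrite inordK.
by rewrite -/(posY l m b) Y0 rmorph0 mulr0.
Qed.

End Pairing.

(** * Comparison of the two summands *)

(* What a point with diagonal entries [x, y, z] contributes to
   [volume_weyl - volume_ST], up to the factor [bsign / 6]. *)
Definition volume_defect (R : realType) (x y z : R) : R :=
  - Num.max (Num.min x (- z)) 0
  + (if (x < 0) && (y < 0) then x else 0)
  - (if (0 < y) && (0 < z) then z else 0).

(** As [x + z = - y], the sign of [y] decides which of [x] and [- z] is smaller. For [y < 0] both
    sides are [min(x, 0) + min(z, 0)]; for [y > 0] both are [- max(x, 0) - max(z, 0)]. *)
Lemma volume_defect_rev (R : realType) (x y z : R) :
  x + y + z = 0 -> y != 0 -> volume_defect x y z = volume_defect z y x.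
Proof.
move=> s0; rewrite /volume_defect neq_lt => /orP[y0|y0].
  rewrite y0 (lt_gtF y0) !andbT !min_r; [|lra|lra].
  rewrite !maxEle !oppr_le0.
  by case: (ltP x 0); case: (ltP z 0) => /= *; lra.
rewrite y0 (lt_gtF y0) !andbF !min_l; [|lra|lra].
rewrite !maxEle.
by case: (ltP 0 x); case: (ltP 0 z) => /= *; lra.
Qed.

Theorem theorem4p2 (R : realType) (l m : 'I_3 -> R)
  (hlm : forall i, l i > m i /\ m i > 0)
  (hA1 : assumption_A1 (xi_of l m))
  (hA2 : assumption_A2 (xi_of l m))
  (hA3 : assumption_A3 (xi_of l m))
  (hl3 : forall i, exists2 a : int, (3 %| a)%Z & l i = a%:~R)
  (hm3 : forall i, exists2 a : int, (3 %| a)%Z & m i = a%:~R)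
  (hgen : forall w : 'I_3 -> 'S_3, ip (odot w (xi_of l m)) (Omega1 R) <> 0) :
  volume_weyl l m (- (1 / 6)) = volume_ST l m.
Proof.
have weylE : volume_weyl l m (- (1 / 6)) = - (1 / 6) *
    \sum_b bsign R b * Num.max (Num.min (posX l m b) (- posZ l m b)) 0.
  rewrite /volume_weyl (reindex weyl_blocks) /=; last first.
    exact/onW_bij/weyl_blocks_bij.
  congr (_ * _); rewrite pair_bigA pair_bigA /=.
  apply: eq_bigr => -[[i j] k] _ /=.
  by have [-> ->] := P12_weyl_blocks l m i j k; rewrite bsign_weyl_blocks.
have STE : volume_ST l m =
    \sum_b ((if (posX l m b < 0) && (posY l m b < 0)
             then - (bsign R b / 6 * posX l m b) else 0) +
            (if (0 < posY l m b) && (0 < posZ l m b)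
             then bsign R b / 6 * posZ l m b else 0)).
  rewrite /volume_ST !sum_six_partition; try by move=> I /andP[].
  rewrite -big_split; apply: eq_bigr => b _ /=.
  have [eX eY eZ] := sum_coord_blk l m b.
  rewrite /inI /inJ /coef_A /coef_B six_partition_blocks /= -[LM3 l m - _ - _]addrA -opprD.
  rewrite eX eY eZ sgnI_blocks !gtrDr !ltrDr.
  congr (_ + _); case: ifP => _ //; ring.
apply/eqP; rewrite -subr_eq0; apply/eqP; rewrite weylE STE mulr_sumr -sumrB.
(* Zero becomes [1 / 6] times the signed sum of [volume_defect], so that the two sides can be
   compared term by term. *)
rewrite -[RHS](mulr0 (1 / 6)) .
rewrite -[X in _ = _ * X](@sum_bsign_rev_eq0 R l m (@volume_defect R)).
  rewrite mulr_sumr; apply: eq_bigr => b _; rewrite /volume_defect.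
  by case: ifP => _; case: ifP => _; field.
by move=> b; rewrite volume_defect_rev ?pos_sum ?posY_neq0.
Qed.
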